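(* Let $\{S_i\}_{i=1}^{n}$ be a finite set of finite nonabelian simple groups, none of which is a subfactor of any other, and let $\mathcal{V}=\mathrm{Var}(\{S_i\})$. Fix some $i_0\in\{1,2,\ldots,n\}$, and let $H$ be a subgroup of $S_{i_0}$. Then $$\mathrm{dom}_{S_{i_0}}^{\mathcal{V}}(H)=\Bigl\{\, s\in S_{i_0} \;\Bigm|\; \text{for all } \phi\in\mathrm{Aut}(S_{i_0}),\ \text{if } \phi|_H=\mathrm{id}|_H \text{ then } \phi(s)=s \,\Bigr\}.$$
   Context: A variety of groups is a class of groups (regarded as a full subcategory of the category of all groups) closed under taking quotients, subgroups and arbitrary direct products. $\mathrm{Var}(\mathcal{X})$ denotes the variety generated by a collection $\mathcal{X}$ of groups, i.e. the smallest variety containing $\mathcal{X}$. A subfactor of a group $G$ is any group of the form $K/N$ where $K$ is a subgroup of $G$ and $N\triangleleft K$; ''$S_i$ is a subfactor of $S_j$'' is understood up to isomorphism, and ''none is a subfactor of any other'' means that for $i\neq j$, $S_i$ is not isomorphic to a subfactor of $S_j$ (in particular the $S_i$ are pairwise non-isomorphic). Given a variety $\mathcal{V}$, a group $G\in\mathcal{V}$ and a subgroup $H\le G$, the dominion of $H$ in $G$ in $\mathcal{V}$ is $$\mathrm{dom}_G^{\mathcal{V}}(H)=\{a\in G \mid \text{for all } C\in\mathcal{V} \text{ and all homomorphisms } f,g\colon G\to C,\ \text{if } f|_H=g|_H \text{ then } f(a)=g(a)\}.$$ *)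

(* Defs.v *)
From HB Require Import structures.
From mathcomp Require Import all_boot all_fingroup all_solvable.
From mathcomp Require Import boolp classical_sets.

Set Implicit Arguments.
Unset Strict Implicit.
Unset Printing Implicit Defensive.

Local Open Scope group_scope.

Section CartesianProduct.
Variables (I : Type) (F : I -> groupType).

(* The unrestricted direct product, with pointwise operations. *)
Definition cartesian_product : Type := forall i, F i.

HB.instance Definition _ := Choice.on cartesian_product.

Definition cart_one : cartesian_product := fun=> 1.
Definition cart_inv (x : cartesian_product) : cartesian_product := fun i => (x i)^-1.
Definition cart_mul (x y : cartesian_product) : cartesian_product :=
  fun i => x i * y i.

Fact cart_mulA : associative cart_mul.
Proof. by move=> x y z; apply: functional_extensionality_dep => i; apply: mulgA. Qed.

Fact cart_mul1 : left_id cart_one cart_mul.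
Proof. by move=> x; apply: functional_extensionality_dep => i; apply: mul1g. Qed.

Fact cart_mulr1 : right_id cart_one cart_mul.
Proof. by move=> x; apply: functional_extensionality_dep => i; apply: mulg1. Qed.

Fact cart_mulV : left_inverse cart_one cart_inv cart_mul.
Proof. by move=> x; apply: functional_extensionality_dep => i; apply: mulVg. Qed.

Fact cart_mulrV : right_inverse cart_one cart_inv cart_mul.
Proof. by move=> x; apply: functional_extensionality_dep => i; apply: mulgV. Qed.

HB.instance Definition _ := isGroup.Build cartesian_product
  cart_mulA cart_mul1 cart_mulr1 cart_mulV cart_mulrV.

End CartesianProduct.

(* Not [set groupType]: groupType is too large for the universe of set. *)
Definition group_class := groupType -> Prop.

(* Classes of groups are understood up to isomorphism: quotients of G are the
   targets of surjective homomorphisms from G, subgroups of G are the sources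
   of injective homomorphisms to G. *)
Record variety (V : group_class) : Prop := Variety {
  variety_quotient : forall (G Q : groupType) (f : {multiplicative G -> Q}),
    (forall y, exists x, f x = y) -> V G -> V Q;
  variety_subgroup : forall (G K : groupType) (f : {multiplicative K -> G}),
    injective f -> V G -> V K;
  variety_product : forall (I : Type) (F : I -> groupType),
    (forall i, V (F i)) -> V (cartesian_product F)
}.

Definition Var (X : group_class) : group_class := fun G =>
  forall V : group_class, variety V -> (forall K, X K -> V K) -> V G.

Definition dominion (V : group_class) (G : groupType) (H : set G) : set G :=
  [set a | forall C : groupType, V C -> forall f g : {multiplicative G -> C},
     (forall h, H h -> f h = g h) -> f a = g a]%classic.

Definition subfactor (gT hT : finGroupType) (A : {group gT}) (B : {group hT}) :=
  exists K N : {group hT}, [/\ K \subset B, N <| K & A \isog K / N].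

(* Main.v *)
Require Import Defs.
From mathcomp Require Import boolp classical_sets.
From HB Require Import structures.
From mathcomp Require Import all_boot all_fingroup all_solvable.

(* Let f, g : S_{i0} -> C agree on H, with C in the variety. The relatively free
   group on two copies of S_{i0} is a subgroup K of a finite product P of copies
   of the S_i, and K maps onto the subgroup of C generated by the two images.
   A minimal subgroup of K covering f(S_{i0}) maps isomorphically to it: by
   minimality, simplicity and the subfactor hypothesis, its kernel lies in the
   kernel of every projection of P. So f and g lift to F, G : S_{i0} -> K, whose
   coordinates are trivial or isomorphisms. The subgroup K0 generated by the
   images of F and G has trivial or nonabelian simple projections, hence every
   normal subgroup N of K0 is cut out by the coordinates in which N is trivial.
   For N the kernel of K0 -> C, the coordinates of F and G where N is trivial
   agree on H, and therefore on every element fixed by all automorphisms fixing H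
   pointwise. *)

Local Open Scope group_scope.

(** * Kernels and subfactors *)

Lemma homg_subfactor {gT hT : finGroupType} {A : {group gT}} {B K : {group hT}} :
  K \subset B -> A \homg K -> subfactor A B.
Proof.
move=> sKB /homgP[f fK]; exists K, ('ker f)%G; split=> //; first exact: ker_normal.
by rewrite -fK isog_sym first_isog.
Qed.

Lemma simple_morphim {gT hT : finGroupType} {G : {group gT}}
    (f : {morphism G >-> hT}) :
  simple G -> (forall x, x \in G -> f x = 1) \/ 'injm f.
Proof.
move=> /simpleP[_ simG]; case: (simG _ (ker_normal f)) => kerf.
  by right; rewrite kerf.
by left=> x Gx; apply/eqP; move: Gx; rewrite -{1}kerf => /morphpreP[_ /set1P ->].
Qed.

(** The target [C] may be infinite, so [f] is a bare function multiplicative on [K], and its kernel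
    is rebuilt here as a finite group. *)
Lemma kernel_normal {gT : finGroupType} {C : groupType} {K : {group gT}}
    {f : gT -> C} :
  {in K &, {morph f : x y / x * y}} ->
  exists N : {group gT}, N <| K /\ forall x, x \in N <-> x \in K /\ f x = 1.
Proof.
move=> fM.
have f1 : f 1 = 1 by apply: (mulgI (f 1)); rewrite -fM ?group1 // !mulg1.
have fV : {in K, forall x, f x^-1 = (f x)^-1}.
  by move=> x Kx; apply: (mulgI (f x)); rewrite -fM ?groupV // !mulgV.
have kerG : group_set [set x in K | f x == 1].
  apply/group_setP; split=> [|x y]; rewrite !inE ?group1 ?f1 ?eqxx //.
  move=> /andP[Kx /eqP fx] /andP[Ky /eqP fy].
  by rewrite groupM // fM // fx fy mulg1 eqxx.
exists (Group kerG); split=> [|x]; last first.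
  by rewrite inE; split=> [/andP[? /eqP]|[-> ->]]; rewrite ?eqxx.
apply/normalP; split=> [|x Kx]; first by apply/subsetP=> x; rewrite inE => /andP[].
apply/setP=> y; rewrite mem_conjg !inE groupJr ?groupV //.
have [Ky /=|//] := boolP (y \in K).
suff -> : f (y ^ x^-1) = f y ^ (f x)^-1 by rewrite conjg_eq1.
by rewrite !conjgE !invgK !fM ?fV ?groupM ?groupV.
Qed.

(** * Lifting homomorphisms along a finite cover *)

Lemma minimal_cover_inj {sT gT : finGroupType} {L : finType}
    {T : L -> finGroupType} {p : forall l, {morphism [set: gT] >-> T l}}
    {K : {group gT}} {phi : {morphism K >-> sT}} :
  simple [set: sT] ->
  (forall l, subfactor [set: sT] [set: T l] -> #|T l| <= #|sT|) ->
  (forall x, (forall l, p l x = 1) -> x = 1) ->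
  phi @* K = [set: sT] ->
  (forall M : {group gT}, M \subset K -> phi @* M = [set: sT] -> M :=: K) ->
  'injm phi.
Proof.
move=> simS cardT p_inj phiK minK; apply/subsetP=> x kerx.
have Kx : x \in K := dom_ker kerx.
apply/set1P; apply: p_inj => l.
pose q := restrm_morphism (subsetT K) (p l).
suff sker : 'ker phi \subset 'ker q.
  by have /mker := subsetP sker x kerx.
have nsq : phi @* 'ker q <| [set: sT] by rewrite -phiK morphim_normal ?ker_normal.
(* If ['ker q] still covers [sT], minimality makes it all of [K] and [q] is trivial; otherwise [phi]
   factors through [q]. *)
have [_ /(_ _ nsq) [] phiq] := simpleP _ simS; last first.
  by rewrite (minK ('ker q)%G) ?subsetIl.
have sqp : 'ker q \subset 'ker phi.
  by rewrite ker_trivg_morphim phiq subxx subsetIl.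
have subf : subfactor [set: sT] [set: T l].
  apply: (homg_subfactor (K := (q @* K)%G)); first exact: subsetT.
  apply/homgP; exists (factm_morphism sqp (subxx K)).
  by rewrite morphim_factm.
have card_ker (rT : finGroupType) (f : {morphism K >-> rT}) :
  (#|'ker f| * #|f @* K| = #|K|)%N by rewrite card_morphim setIid Lagrange ?subsetIl.
have cardq : #|q @* K| <= #|sT|.
  by apply: leq_trans (cardT l subf); rewrite max_card.
(* Both kernels have index in [K] given by the image: that of [q] is at most #|sT|, that of [phi]
   equals it, so the inclusion [sqp] is an equality. *)
have := card_ker _ phi; rewrite phiK cardsT -(card_ker _ q) => cardE.
suff /eqP -> : 'ker q == 'ker phi by [].
rewrite eqEcard sqp -(@leq_pmul2r #|sT|); last by rewrite -cardsT cardG_gt0.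
by rewrite cardE leq_mul2l cardq orbT.
Qed.

(** By simplicity [f] is trivial, with trivial lift, or injective. In the second case [F] inverts
    the isomorphism from a minimal covering subgroup [M] onto [sT]. *)
Lemma lift_simple {sT gT : finGroupType} {L : finType}
    {T : L -> finGroupType} {p : forall l, {morphism [set: gT] >-> T l}}
    {C : groupType} {K : {group gT}} {pr : gT -> C}
    (f : {multiplicative sT -> C}) :
  simple [set: sT] ->
  (forall l, subfactor [set: sT] [set: T l] -> #|T l| <= #|sT|) ->
  (forall x, (forall l, p l x = 1) -> x = 1) ->
  {in K &, {morph pr : x y / x * y}} ->
  (forall a, exists2 k, k \in K & pr k = f a) ->
  exists F : {morphism [set: sT] >-> gT}, forall a, F a \in K /\ pr (F a) = f a.
Proof.
move=> simS cardT p_inj prM prK.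
have pr_1 : pr 1 = 1 by apply: (mulgI (pr 1)); rewrite -prM ?group1 // !mulg1.
have fM a b : f (a * b) = f a * f b by exact: gmulfM.
have f1 : f 1 = 1 by apply: (mulgI (f 1)); rewrite -fM !mulg1.
have [Z [nsZ ZP]] := @kernel_normal _ C [set: sT]%G f (in2W fM).
have [_ /(_ _ nsZ) [] ZE] := simpleP _ simS; last first.
  exists [morphism of @trivm sT gT [set: sT]] => a; split; first exact: group1.
  by have /ZP[_ ->] : a \in Z by rewrite ZE inE.
have f_inj : injective f.
  move=> a b fab; apply: (mulIg b^-1); rewrite mulgV; apply/set1P.
  by rewrite -[[set 1]]ZE; apply/ZP; rewrite inE fM fab -fM mulgV.
have KfG : group_set [set k in K | [exists a, pr k == f a]].
  apply/group_setP; split=> [|k1 k2]; rewrite !inE.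
    by rewrite group1; apply/existsP; exists 1; rewrite pr_1 f1.
  move=> /andP[K1 /existsP[a /eqP ka]] /andP[K2 /existsP[b /eqP kb]].
  rewrite groupM //; apply/existsP; exists (a * b).
  by rewrite prM // ka kb fM.
pose covers (M : {group gT}) :=
  (M \subset Group KfG) && [forall a, exists k in M, pr k == f a].
have cov_Kf : covers (Group KfG).
  rewrite /covers subxx; apply/forallP=> a; have [k Kk ka] := prK a.
  apply/exists_inP; exists k; rewrite ?ka // inE Kk.
  by apply/existsP; exists a; rewrite ka.
have [M /mingroupP[/andP[sMKf covM] minM] _] := mingroup_exists cov_Kf.
have sMK : M \subset K.
  by apply: subset_trans sMKf _; apply/subsetP=> k; rewrite inE => /andP[].
(* This is [pr] followed by the inverse of [f]; the default [1] is never taken on [M]. *)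
pose lft k := odflt 1 [pick a | f a == pr k].
have lftE : {in M, forall k, f (lft k) = pr k}.
  move=> k /(subsetP sMKf); rewrite inE /lft => /andP[_ /existsP[a ka]].
  by case: pickP => [b /eqP //|/(_ a)]; rewrite eq_sym ka.
have lftM : {in M &, {morph lft : x y / x * y}}.
  move=> x y Mx My; apply: f_inj.
  by rewrite fM !lftE ?groupM // prM ?(subsetP sMK).
pose phi := Morphism lftM.
have phi_lift k : k \in M -> f (phi k) = pr k by exact: lftE.
have phiP (N : {group gT}) : N \subset M ->
    reflect (phi @* N = [set: sT]) [forall a, exists k in N, pr k == f a].
  move=> sNM; apply: (iffP forallP) => [cov|phiN a].
    apply/setP=> a; rewrite inE; have /exists_inP[k Nk /eqP ka] := cov a.
    have Mk := subsetP sNM k Nk.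
    by apply/morphimP; exists k => //; apply: f_inj; rewrite phi_lift.
  have: a \in phi @* N by rewrite phiN.
  case/morphimP=> k Mk Nk ->; apply/exists_inP; exists k => //.
  by rewrite phi_lift.
have phi_im : phi @* M = [set: sT] by apply/phiP.
have phi_inj : 'injm phi.
  apply: (minimal_cover_inj simS cardT p_inj phi_im) => N sNM /phiP covN.
  by apply: minM => //; rewrite /covers (subset_trans sNM) ?covN.
have im_inv : [set: sT] \subset phi @* M by rewrite phi_im.
exists (restrm_morphism im_inv (invm_morphism phi_inj)) => a.
have: a \in phi @* M by rewrite phi_im.
case/morphimP=> k _ Mk ->; rewrite /= /restrm invmE //; split.
  exact: (subsetP sMK).
by rewrite phi_lift.
Qed.

(** * Normal subgroups of subdirect products of simple groups *)

(* The coordinates [l] with [p l @* N != 1] can be ignored one at a time: there,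
   two normal subgroups of [K] with full image have a commutator with full image,
   since that image is perfect. *)
Lemma normal_subgroup_separated {gT : finGroupType} {L : finType}
    {T : L -> finGroupType} {p : forall l, {morphism [set: gT] >-> T l}}
    {K N : {group gT}} {x : gT} :
  (forall y, (forall l, p l y = 1) -> y = 1) ->
  (forall l, p l @* K = 1 \/ simple (p l @* K) /\ ~~ abelian (p l @* K)) ->
  N <| K -> x \in K -> (forall l, p l @* N = 1 -> p l x = 1) -> x \in N.
Proof.
move=> p_inj pK nsNK Kx pNx; have [sNK nNK] := andP nsNK.
(* [r] lists the coordinates left free, apart from those where [N] is trivial: [E [::]] is trivial
   and [E (enum L)] contains [x]. *)
pose E (r : seq L) := (K :&: \bigcap_(l | (p l @* N == 1) || (l \notin r)) 'ker (p l))%G.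
have EP r y : reflect
    (y \in K /\ forall l, (p l @* N == 1) || (l \notin r) -> p l y = 1) (y \in E r).
  rewrite inE; apply: (iffP andP) => -[Ky yE]; split=> //.
    by move=> l Pl; apply: mker; apply: (bigcapP yE).
  by apply/bigcapP=> l Pl; apply/kerP; rewrite ?inE ?yE.
suff sEN (r : seq L) : E r \subset N.
  apply: (subsetP (sEN (enum L))); apply/EP; split=> // l.
  by rewrite mem_enum orbF => /eqP; apply: pNx.
elim: r => [|l r IHr]; apply/subsetP=> y /EP[Ky yE].
  by rewrite (p_inj y) // => l; apply: yE; rewrite orbT.
have [pN1|pN1] := eqVneq (p l @* N) 1.
  apply: (subsetP IHr); apply/EP; split=> // k /orP[Pk|Pk].
    by apply: yE; rewrite Pk.
  have [->|nkl] := eqVneq k l; first by apply: yE; rewrite pN1 eqxx.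
  by apply: yE; rewrite inE negb_or nkl Pk orbT.
have [pK1|[simK nabK]] := pK l.
  by case/eqP: pN1; apply/trivgP; rewrite -pK1 morphimS.
have [_ simK'] := simpleP _ simK.
have nsEK : E (l :: r) <| K.
  apply/andP; split; first exact: subsetIl.
  rewrite normsI ?normG // norms_bigcap //; apply/bigcapsP=> k _.
  by rewrite (subset_trans (subsetT K)) // ker_norm.
have [pE1|pEK] := simK' _ (morphim_normal (p l) nsEK).
  apply: (subsetP IHr); apply/EP; split=> // k Pk.
  have [->|nkl] := eqVneq k l.
    have yEr : y \in E (l :: r) by apply/EP.
    by apply/set1P; rewrite -[[set 1]]pE1 mem_morphim ?in_setT.
  by apply: yE; rewrite inE negb_or nkl.
have [/eqP|pNK] := simK' _ (morphim_normal (p l) nsNK); first by rewrite (negPf pN1).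
have der : [~: p l @* K, p l @* K] = p l @* K.
  have [/commG1P abK|//] := simK' _ (der_normal 1 (p l @* K)).
  by rewrite /abelian abK in nabK.
(* The commutator lies in both [E (l :: r)] and [N], so it provides [z] in [N] with the same
   coordinate [l] as [y]; then [y * z^-1] falls in [E r]. *)
have: p l y \in p l @* [~: E (l :: r), N].
  by rewrite morphimR ?subsetT // pEK pNK der mem_morphim ?in_setT.
case/morphimP=> z _ zEN pyz.
have zN : z \in N.
  by apply: subsetP zEN; rewrite commg_subr (subset_trans _ nNK) // subsetIl.
have zE : z \in E (l :: r).
  by apply: subsetP zEN; rewrite commg_subl (subset_trans sNK) // normal_norm.
have [Kz {}zE] := EP _ _ zE.
rewrite -[y](mulgKV z) groupMr //; apply: (subsetP IHr); apply/EP.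
split=> [|k Pk]; first by rewrite groupM ?groupV.
rewrite morphM ?morphV ?inE //; have [->|nkl] := eqVneq k l.
  by rewrite pyz mulgV.
by rewrite yE ?zE ?mulgV // inE negb_or nkl.
Qed.

(** * Identities and relatively free groups *)

(* Words without inverses suffice: the [S i] are finite, so there inverses are
   positive powers. *)
Definition satisfies_identities {n : nat} (S : 'I_n -> finGroupType) (X : Type) :
    group_class := fun G =>
  forall w1 w2 : seq X,
    (forall j (u : X -> S j), \prod_(x <- w1) u x = \prod_(x <- w2) u x) ->
    forall v : X -> G, \prod_(x <- w1) v x = \prod_(x <- w2) v x.

Lemma multiplicative_prod {G K : groupType} (f : {multiplicative G -> K})
    {X : Type} (v : X -> G) (w : seq X) :
  f (\prod_(x <- w) v x) = \prod_(x <- w) f (v x).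
Proof.
apply: (big_morph f (id1 := 1)) => [x y|]; first exact: gmulfM.
by apply: (mulgI (f 1)); rewrite -gmulfM !mulg1.
Qed.

(** The easy direction of Birkhoff's theorem; since [Var] is the smallest variety, its members
    inherit the common identities of the [S i]. *)
Lemma satisfies_identities_variety {n : nat} (S : 'I_n -> finGroupType) (X : Type) :
  variety (satisfies_identities S X).
Proof.
split=> [G Q f f_surj idG w1 w2 idw v|G K f f_inj idG w1 w2 idw v|I F idF w1 w2 idw v].
- have [v' v'E] := choice (fun x => f_surj (v x)).
  have vE w : \prod_(x <- w) v x = f (\prod_(x <- w) v' x).
    by rewrite multiplicative_prod; apply: eq_bigr => x _; rewrite v'E.
  by rewrite !vE (idG _ _ idw).
- by apply: f_inj; rewrite !multiplicative_prod; apply: idG.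
- have proj w i : (\prod_(x <- w) v x : cartesian_product F) i = \prod_(x <- w) v x i.
    exact: (big_morph (fun y : cartesian_product F => y i)).
  by apply: functional_extensionality_dep => i; rewrite !proj; apply: idF.
Qed.

(** [K] is the relatively free group on [X], realized in the product of the [S j] over all
    assignments [X -> S j]. Words equal in [K] form an identity of all [S j], so their values in [C]
    agree and [pr] is well defined. *)
Lemma finite_cover {n : nat} {S : 'I_n -> finGroupType} {X : finType}
    {C : groupType} (v : X -> C) :
  satisfies_identities S X C ->
  exists (gT : finGroupType) (K : {group gT}) (pr : gT -> C) (L : finType)
    (j : L -> 'I_n) (p : forall l, {morphism [set: gT] >-> S (j l)}),
  [/\ forall y, (forall l, p l y = 1) -> y = 1,
      {in K &, {morph pr : x y / x * y}} &
      forall x, exists2 k, k \in K & pr k = v x].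
Proof.
move=> idC.
pose L : finType := {j : 'I_n & {ffun X -> S j}}.
pose gT : finGroupType := {dffun forall l : L, S (tag l)}.
pose e (x : X) : gT := [ffun l : L => tagged l x].
have eE (w : seq X) l : (\prod_(x <- w) e x) l = \prod_(x <- w) tagged l x.
  rewrite (big_morph (fun y : gT => y l) (@dffunM _ _ l) (ffunE _ _)).
  by apply: eq_bigr => x _; rewrite ffunE.
have eval_eq w1 w2 : \prod_(x <- w1) e x = \prod_(x <- w2) e x ->
    \prod_(x <- w1) v x = \prod_(x <- w2) v x.
  move=> e12; apply: idC => j u.
  have uE w : \prod_(x <- w) u x = (\prod_(x <- w) e x) (Tagged (fun j => {ffun X -> S j}) (finfun u)).
    by rewrite eE; apply: eq_bigr => x _ /=; rewrite ffunE.
  by rewrite !uE e12.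
pose words := [set k : gT | `[< exists w, k = \prod_(x <- w) e x >]].
(* In a finite group, closure under products gives inverses. *)
have Kgroup : group_set words.
  apply/group_setP; split=> [|y z]; rewrite !inE.
    by apply/asboolP; exists [::]; rewrite big_nil.
  move=> /asboolP[w1 ->] /asboolP[w2 ->]; apply/asboolP.
  by exists (w1 ++ w2); rewrite big_cat.
pose word k := xget [::] [set w | k = \prod_(x <- w) e x]%classic.
have wordE w : \prod_(x <- word (\prod_(x <- w) e x)) e x = \prod_(x <- w) e x.
  by rewrite /word; case: xgetP => [w' _ /= <-//|/(_ w)[]].
pose pr k := \prod_(x <- word k) v x.
have prE w : pr (\prod_(x <- w) e x) = \prod_(x <- w) v x.
  by apply: eval_eq; rewrite wordE.
exists gT, (Group Kgroup), pr, L, (fun l => tag l), (fun l => dffun_morphism _ l).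
split=> [y y1|y z|x].
- by apply/ffunP=> l; rewrite ffunE; apply: y1.
- rewrite !inE => /asboolP[w1 ->] /asboolP[w2 ->].
  by rewrite -big_cat !prE big_cat.
- exists (e x); first by rewrite inE; apply/asboolP; exists [:: x]; rewrite big_seq1.
  by have := prE [:: x]; rewrite !big_seq1.
Qed.

(** * Pairs of homomorphisms from a simple group *)

(** If both maps are injective, the order bound makes them bijective, and [alpha] followed by the
    inverse of [beta] is an automorphism fixing [H]. If exactly one is trivial, so is [H]. *)
Lemma aut_fixed_agree {sT tT : finGroupType}
    {alpha beta : {morphism [set: sT] >-> tT}} {H : {group sT}} {s : sT} :
  simple [set: sT] -> ~~ abelian [set: sT] ->
  ('injm alpha \/ 'injm beta -> #|tT| <= #|sT|) ->
  {in H, alpha =1 beta} ->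
  (forall phi : {perm sT}, phi \in Aut [set: sT] ->
     (forall h, h \in H -> phi h = h) -> phi s = s) ->
  alpha s = beta s.
Proof.
move=> simS nabS cardT abH fix_s.
(* Inner automorphisms fix a trivial [H], so [s] lies in the centre, which is trivial. *)
have fixed_trivial : (forall h, h \in H -> h = 1) -> s = 1.
  move=> H1; have sZ : s \in 'Z([set: sT]).
    apply/centerP; split=> [|y _]; first exact: in_setT.
    apply/commgP/conjg_fixP.
    rewrite -(@conj_autE _ [set: sT]%G) ?in_setT //; apply: fix_s => [|h /H1 ->].
      by apply: (subsetP (Aut_conj_aut _ [set: sT])); rewrite mem_morphim ?(subsetP (normG _)) ?in_setT.
    by rewrite conj_autE ?in_setT ?conj1g.
  have [_ simS'] := simpleP _ simS.
  have [ZE|/center_idP abS] := simS' _ (center_normal [set: sT]).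
    by move: sZ; rewrite [center _]ZE => /set1P.
  by rewrite abS in nabS.
have [a1|a_inj] := simple_morphim alpha simS;
  have [b1|b_inj] := simple_morphim beta simS.
- by rewrite a1 ?b1 ?inE.
- rewrite fixed_trivial ?morph1 // => h Hh.
  by apply: (injmP b_inj); rewrite ?inE // morph1 -abH ?a1 ?inE.
- rewrite fixed_trivial ?morph1 // => h Hh.
  by apply: (injmP a_inj); rewrite ?inE // morph1 abH ?b1 ?inE.
have full (m : {morphism [set: sT] >-> tT}) : 'injm m -> m @* [set: sT] = [set: tT].
  move=> m_inj; apply/eqP; rewrite eqEcard subsetT card_injm // !cardsT.
  by apply: cardT; left.
have sub : [set: tT] \subset beta @* [set: sT] by rewrite full.
pose gamma := restrm_morphism sub (invm_morphism b_inj).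
have gammaE a : gamma (beta a) = a by rewrite /= /restrm invmE ?inE.
pose delta_fun a := gamma (alpha a).
have deltaM : {in [set: sT] &, {morph delta_fun : x y / x * y}}.
  by move=> a b _ _; rewrite /delta_fun !morphM ?inE.
pose delta := Morphism deltaM.
have gamma_inj : injective gamma.
  by apply: (can_inj (g := beta)) => y; rewrite /= /restrm invmK ?(subsetP sub) ?inE.
have delta_inj : 'injm delta.
  by apply/injmP=> a b _ _ /gamma_inj; apply: (injmP a_inj); rewrite inE.
have deltaT : delta @* [set: sT] = [set: sT].
  by apply/eqP; rewrite eqEcard subsetT card_injm ?leqnn.
have := fix_s _ (Aut_aut delta_inj deltaT); rewrite autE ?inE // => fixd.
have ds : delta s = s by apply: fixd => h Hh; rewrite autE ?inE //= /delta_fun abH // gammaE.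
by apply: gamma_inj; rewrite gammaE.
Qed.

(** * Dominions in the simple generators *)

Theorem theorem4p26 (n : nat) (S : 'I_n -> finGroupType)
    (S_simple : forall i, simple [set: S i])
    (S_nonabelian : forall i, ~~ abelian [set: S i])
    (S_subfactor : forall i j, i != j -> ~ subfactor [set: S i] [set: S j])
    (i0 : 'I_n) (H : {group S i0}) :
  dominion (Var (fun G => exists i, G = S i)) [set` H]%classic =
  [set s | forall phi : {perm S i0}, phi \in Aut [set: S i0]%SET ->
             (forall h, h \in H -> phi h = h) -> phi s = s]%classic.
Proof.
apply/seteqP; split=> [s sdom phi Aphi phiH|s fix_s C VC f g fgH] /=.
  have phiM : {morph phi : x y / x * y}.
    by move=> x y; apply: (morphicP (Aut_morphic Aphi)); rewrite inE.
  (* The dominion condition is tested on [phi] and the identity of [S i0]. *)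
  pose phi' : {multiplicative S i0 -> S i0} :=
    HB.pack (phi : S i0 -> S i0) (isMultiplicative.Build _ _ _ phiM).
  symmetry; apply: (sdom (S i0) _ idfun phi') => [V _|h Hh]; first by apply; exists i0.
  by rewrite /= phiH.
have cardS j : subfactor [set: S i0] [set: S j] -> #|S j| <= #|S i0|.
  by have [<-//|/S_subfactor nsub /nsub] := eqVneq i0 j.
pose X : finType := (S i0 + S i0)%type.
pose v (x : X) := match x with inl a => f a | inr a => g a end.
have idC : satisfies_identities S X C.
  apply: VC; first exact: satisfies_identities_variety.
  by move=> _ [j ->] w1 w2; apply.
have [gT [K [pr [L [j [p [p_inj prM prK]]]]]]] := finite_cover v idC.
have cardT l : subfactor [set: S i0] [set: S (j l)] -> #|S (j l)| <= #|S i0|.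
  exact: cardS.
have [F FP] := lift_simple f (S_simple i0) cardT p_inj prM (fun a => prK (inl a)).
have [G GP] := lift_simple g (S_simple i0) cardT p_inj prM (fun a => prK (inr a)).
have injm_card l (m : {morphism [set: S i0] >-> S (j l)}) :
    'injm m -> #|S (j l)| <= #|S i0|.
  move=> m_inj; apply: cardT; apply: (homg_subfactor (K := (m @* [set: S i0])%G)).
    exact: subsetT.
  by apply: isog_hom; exact: sub_isog.
have compM (E : {morphism [set: S i0] >-> gT}) l :
    {in [set: S i0] &, {morph (fun a => p l (E a)) : x y / x * y}}.
  by move=> a b _ _; rewrite !morphM ?inE.
pose comp E l := Morphism (compM E l).
(* Unlike [K], the group [K0] is generated by the two lifts alone, which forces each projection to
   be trivial or all of [S (j l)]. *)
pose K0 := (F @* [set: S i0] <*> G @* [set: S i0])%G.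
have K0F a : F a \in K0 by apply/mem_gen/setUP; left; rewrite mem_morphim ?inE.
have K0G a : G a \in K0 by apply/mem_gen/setUP; right; rewrite mem_morphim ?inE.
have sK0K : K0 \subset K.
  rewrite gen_subG subUset; apply/andP; split; apply/subsetP=> _ /morphimP[a _ _ ->].
    by case: (FP a).
  by case: (GP a).
have prM0 : {in K0 &, {morph pr : x y / x * y}} by apply: sub_in2 prM; apply/subsetP.
have full_im (E : {morphism [set: S i0] >-> gT}) l :
    (forall a, E a \in K0) -> 'injm (comp E l) -> p l @* K0 = [set: S (j l)].
  move=> K0E E_inj; apply/eqP; rewrite eqEsubset subsetT.
  have <- : comp E l @* [set: S i0] = [set: S (j l)].
    apply/eqP; rewrite eqEcard subsetT card_injm // !cardsT.
    exact: injm_card E_inj.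
  by apply/subsetP=> _ /morphimP[a _ _ ->]; apply: (mem_morphim (p l)); rewrite ?in_setT.
have pK0 l : p l @* K0 = 1 \/ simple (p l @* K0) /\ ~~ abelian (p l @* K0).
  have [F1|F_inj] := simple_morphim (comp F l) (S_simple i0); last first.
    by right; rewrite (full_im F).
  have [G1|G_inj] := simple_morphim (comp G l) (S_simple i0); last first.
    by right; rewrite (full_im G).
  left; apply/trivgP; rewrite sub_morphim_pre ?subsetT // gen_subG subUset.
  apply/andP; split; apply/subsetP=> _ /morphimP[a _ _ ->]; apply/kerP; rewrite ?inE //.
    exact: F1.
  exact: G1.
have [N [nsN NP]] := kernel_normal prM0.
suff: F s * (G s)^-1 \in N.
  case/NP=> K0x prx; case: (FP s) => _ <-; case: (GP s) => _ <-.
  by rewrite -[F s](mulgKV (G s)) prM0 // prx mul1g.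
apply: (normal_subgroup_separated p_inj pK0 nsN) => [|l pN1].
  by rewrite groupM ?groupV.
suff pFG : comp F l s = comp G l s by rewrite morphM ?morphV ?inE // [p l (F s)]pFG mulgV.
apply: (aut_fixed_agree (S_simple i0) (S_nonabelian i0) _ _ fix_s) => [[]|h Hh].
- exact: injm_card.
- exact: injm_card.
(* Since [f h = g h], the quotient of the two lifts of [h] lies in [N], which is trivial in
   coordinate [l]. *)
have : p l (F h * (G h)^-1) \in p l @* N.
  rewrite mem_morphim ?inE //; apply/NP; rewrite groupM ?groupV //; split=> //.
  have prE : pr (F h) = pr (G h).
    by case: (FP h) => _ ->; case: (GP h) => _ ->; apply: fgH.
  apply: (mulIg (pr (G h))); rewrite -prM0 ?groupM ?groupV // mulgKV mul1g.
  exact: prE.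
by rewrite pN1 morphM ?morphV ?in_setT // => /set1P /(canRL (mulgKV _)); rewrite mul1g.
Qed.
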